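(* Let $N$ be a surface (real dimension $2$) in a Kaehlerian manifold $(M,g,J)$. Then $N$ is slant if and only if $A_{FY}X=A_{FX}Y$ for all vectors $X,Y$ tangent to $N$.
   Context: Manifolds are smooth and connected. For $X$ tangent to $N$, $FX$ denotes the normal component of $JX$. $A$ is the Weingarten map, $\langle A_\xi X,Y\rangle=\langle h(X,Y),\xi\rangle$, with $h$ the second fundamental form. $N$ is slant if the angle $\theta(X)$ between $JX$ and $T_xN$ is a constant independent of $x\in N$ and of nonzero $X\in T_xN$ (complex and totally real surfaces, with $\theta\equiv0$ and $\theta\equiv\pi/2$, are included). *)

(* Defs.v *)
From mathcomp Require Import all_boot all_order all_algebra.
From mathcomp Require Import all_classical all_reals all_analysis.

Set Implicit Arguments.
Unset Strict Implicit.
Unset Printing Implicit Defensive.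

Import Order.TTheory GRing.Theory Num.Theory.
Import numFieldNormedType.Exports.
Local Open Scope classical_set_scope.
Local Open Scope ring_scope.

(* On an open set [U], [Ck k U f] is the usual class C^k: the (finite
   dimensional) differential is C^k iff all directional derivatives are. *)
Fixpoint Ck (R : realType) (V W : normedModType R) (k : nat) (U : set V)
    (f : V -> W) : Prop :=
  match k with
  | 0%N => forall x, U x -> {for x, continuous f}
  | k'.+1 => (forall x, U x -> differentiable f x) /\
             (forall v : V, Ck k' U ('D_v f))
  end.

Definition smooth_on (R : realType) (V W : normedModType R) (U : set V)
    (f : V -> W) : Prop := forall k, Ck k U f.

(* [chart_map] is only meaningful on [chart_dom] and [chart_inv] on
   [chart_cod]; both are total functions with arbitrary values elsewhere. *)
Record chart (R : realType) (n : nat) (M : topologicalType) := Chart {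
  chart_dom : set M ;
  chart_cod : set 'rV[R]_n ;
  chart_map : M -> 'rV[R]_n ;
  chart_inv : 'rV[R]_n -> M ;
  chart_dom_open : open chart_dom ;
  chart_cod_open : open chart_cod ;
  chart_mapP : forall p, chart_dom p -> chart_cod (chart_map p) ;
  chart_invP : forall u, chart_cod u -> chart_dom (chart_inv u) ;
  chart_mapK : forall p, chart_dom p -> chart_inv (chart_map p) = p ;
  chart_invK : forall u, chart_cod u -> chart_map (chart_inv u) = u ;
  chart_map_continuous :
    forall p, chart_dom p -> {for p, continuous chart_map} ;
  chart_inv_continuous :
    forall u, chart_cod u -> {for u, continuous chart_inv} }.

(* Expression of [f : N -> M] in the charts [c] of [N] and [d] of [M], and
   the set of coordinates on which it is meaningful. *)
Definition local_rep (R : realType) (n m : nat) (N M : topologicalType)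
    (f : N -> M) (c : chart R n N) (d : chart R m M) : 'rV[R]_n -> 'rV[R]_m :=
  fun u => chart_map d (f (chart_inv c u)).

Definition local_dom (R : realType) (n m : nat) (N M : topologicalType)
    (f : N -> M) (c : chart R n N) (d : chart R m M) : set 'rV[R]_n :=
  [set u | chart_cod c u /\ chart_dom d (f (chart_inv c u))].

Record manifold (R : realType) (n : nat) := Manifold {
  carrier :> topologicalType ;
  atlas : set (chart R n carrier) ;
  atlas_cover : forall p : carrier, exists2 c, atlas c & chart_dom c p ;
  atlas_smooth : forall c d, atlas c -> atlas d ->
    smooth_on (local_dom idfun c d) (local_rep idfun c d) ;
  manifold_hausdorff : hausdorff_space carrier ;
  manifold_second_countable : @second_countable carrier ;
  manifold_connected : connected [set: carrier] }.

(* Tangent vectors are given by their components (row vectors) in the charts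
   of the atlas; at a point of two charts [c] and [d] the components change by
   v |-> v *m T, with T the Jacobian matrix of the transition map. Tensor
   fields are given by their components in every chart, as functions of the
   coordinates, subject to the corresponding transformation law. *)

Definition inner (R : realType) (m : nat) (G : 'M[R]_m) (v w : 'rV[R]_m) : R :=
  (v *m G *m w^T) 0 0.

Record riemannian_metric (R : realType) (m : nat) (M : manifold R m) :=
  RiemannianMetric {
    metric :> chart R m M -> 'rV[R]_m -> 'M[R]_m ;
    metric_smooth : forall c, atlas c ->
      smooth_on (chart_cod c) (metric c) ;
    metric_transform : forall c d, atlas c -> atlas d ->
      forall u, local_dom idfun c d u ->
      let T := jacobian (local_rep idfun c d) u in
      metric c u = T *m metric d (local_rep idfun c d u) *m T^T ;
    metric_sym : forall c, atlas c -> forall u, chart_cod c u ->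
      forall v w, inner (metric c u) v w = inner (metric c u) w v ;
    metric_pos : forall c, atlas c -> forall u, chart_cod c u ->
      forall v, v != 0 -> 0 < inner (metric c u) v v }.

(* The endomorphism J acts on components by v |-> v *m acs c u. *)
Record almost_complex (R : realType) (m : nat) (M : manifold R m) :=
  AlmostComplex {
    acs :> chart R m M -> 'rV[R]_m -> 'M[R]_m ;
    acs_smooth : forall c, atlas c -> smooth_on (chart_cod c) (acs c) ;
    acs_transform : forall c d, atlas c -> atlas d ->
      forall u, local_dom idfun c d u ->
      let T := jacobian (local_rep idfun c d) u in
      acs c u *m T = T *m acs d (local_rep idfun c d u) ;
    acs_square : forall c, atlas c -> forall u, chart_cod c u ->
      acs c u *m acs c u = - 1%:M }.

(* Christoffel symbol Gamma^k_ij of the Levi-Civita connection of a metric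
   with components [G]. *)
Definition christoffel (R : realType) (m : nat) (G : 'rV[R]_m -> 'M[R]_m)
    (y : 'rV[R]_m) (k i j : 'I_m) : R :=
  let dG (l a b : 'I_m) : R :=
    'D_(delta_mx 0 l : 'rV[R]_m) (fun z => G z a b : R^o) y in
  2^-1 * \sum_(l < m) invmx (G y) k l * (dG i j l + dG j i l - dG l i j).

Definition Gamma (R : realType) (m : nat) (G : 'rV[R]_m -> 'M[R]_m)
    (y : 'rV[R]_m) (v w : 'rV[R]_m) : 'rV[R]_m :=
  \row_k \sum_(i < m) \sum_(j < m) christoffel G y k i j * v 0 i * w 0 j.

(* Covariant derivative, in the direction [v] at [u], of the vector field [V]
   along the map [f]; for [f = idfun] this is the Levi-Civita connection. *)
Definition covd (R : realType) (n m : nat) (G : 'rV[R]_m -> 'M[R]_m)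
    (f : 'rV[R]_n -> 'rV[R]_m) (V : 'rV[R]_n -> 'rV[R]_m)
    (v u : 'rV[R]_n) : 'rV[R]_m :=
  'D_v V u + Gamma G (f u) ('d f u v) (V u).

(* Almost Hermitian with J parallel: (nabla_v J) w =
   nabla_v (J w) - J (nabla_v w), evaluated on fields [w] with constant
   components, which suffices since nabla J is a tensor. *)
Definition kaehlerian (R : realType) (m : nat) (M : manifold R m)
    (g : riemannian_metric M) (J : almost_complex M) : Prop :=
  forall c, atlas c -> forall u, chart_cod c u ->
  (forall v w, inner (g c u) (v *m J c u) (w *m J c u) = inner (g c u) v w) /\
  (forall v w : 'rV[R]_m,
    covd (g c) idfun (fun z => w *m J c z) v u =
    covd (g c) idfun (fun=> w) v u *m J c u).

Record immersion (R : realType) (n m : nat) (N : manifold R n)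
    (M : manifold R m) := Immersion {
  imm :> N -> M ;
  imm_continuous : continuous imm ;
  imm_smooth : forall c d, atlas c -> atlas d ->
    smooth_on (local_dom imm c d) (local_rep imm c d) ;
  imm_injective : forall c d, atlas c -> atlas d ->
    forall u, local_dom imm c d u ->
    injective ('d (local_rep imm c d) u) }.

Definition gnorm (R : realType) (m : nat) (G : 'M[R]_m) (v : 'rV[R]_m) : R :=
  Num.sqrt (inner G v v).

Definition angle (R : realType) (m : nat) (G : 'M[R]_m) (v w : 'rV[R]_m) : R :=
  acos (inner G v w / (gnorm G v * gnorm G w)).

(* Angle between a vector and a linear subspace: the least angle with a
   nonzero vector of the subspace. *)
Definition angle_to (R : realType) (m : nat) (G : 'M[R]_m) (v : 'rV[R]_m)
    (T : set 'rV[R]_m) : R :=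
  inf [set angle G v w | w in [set w | T w /\ w != 0]].

(* The default value 0 of [xget] is never used when [G] is positive definite
   and [T] is a linear subspace. *)
Definition tangential (R : realType) (m : nat) (G : 'M[R]_m)
    (T : set 'rV[R]_m) (v : 'rV[R]_m) : 'rV[R]_m :=
  xget 0 [set t | T t /\ forall w, T w -> inner G (v - t) w = 0].

Definition normal (R : realType) (m : nat) (G : 'M[R]_m)
    (T : set 'rV[R]_m) (v : 'rV[R]_m) : 'rV[R]_m := v - tangential G T v.

(* Below, [u] are the coordinates in the chart [c] of a point x of the
   submanifold N, [d] is a chart of the ambient manifold around f x, and X, Y
   are the components in [c] of vectors tangent to N at x, identified with
   vectors tangent to the ambient manifold by the differential of [f]. *)

Definition tangent_map (R : realType) (n m : nat) (N : manifold R n)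
    (M : manifold R m) (f : immersion N M) (c : chart R n N)
    (d : chart R m M) (u X : 'rV[R]_n) : 'rV[R]_m :=
  'd (local_rep f c d) u X.

Definition tangent_space (R : realType) (n m : nat) (N : manifold R n)
    (M : manifold R m) (f : immersion N M) (c : chart R n N)
    (d : chart R m M) (u : 'rV[R]_n) : set 'rV[R]_m :=
  range (tangent_map f c d u).

(* Components in [d] of the ambient metric and of J X at f x. *)
Definition ambient_metric (R : realType) (n m : nat) (N : manifold R n)
    (M : manifold R m) (g : riemannian_metric M) (f : immersion N M)
    (c : chart R n N) (d : chart R m M) (u : 'rV[R]_n) : 'M[R]_m :=
  g d (local_rep f c d u).

Definition J_tangent (R : realType) (n m : nat) (N : manifold R n)
    (M : manifold R m) (J : almost_complex M) (f : immersion N M)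
    (c : chart R n N) (d : chart R m M) (u X : 'rV[R]_n) : 'rV[R]_m :=
  tangent_map f c d u X *m J d (local_rep f c d u).

(* The normal component FX of J X, in components in [d]. *)
Definition F_normal (R : realType) (n m : nat) (N : manifold R n)
    (M : manifold R m) (g : riemannian_metric M) (J : almost_complex M)
    (f : immersion N M) (c : chart R n N) (d : chart R m M)
    (u X : 'rV[R]_n) : 'rV[R]_m :=
  normal (ambient_metric g f c d u) (tangent_space f c d u)
    (J_tangent J f c d u X).

(* h(X, Y), the normal component of nabla_X Y, where Y is extended by a field
   with constant components in [c]; h is tensorial, so that the choice of the
   extension is immaterial. *)
Definition second_fundamental_form (R : realType) (n m : nat)
    (N : manifold R n) (M : manifold R m) (g : riemannian_metric M)
    (f : immersion N M) (c : chart R n N) (d : chart R m M)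
    (u X Y : 'rV[R]_n) : 'rV[R]_m :=
  normal (ambient_metric g f c d u) (tangent_space f c d u)
    (covd (g d) (local_rep f c d) (fun z => tangent_map f c d z Y) X u).

(* A_xi X, the tangent vector W with <W, Y> = <h(X, Y), xi> for all Y. *)
Definition weingarten (R : realType) (n m : nat) (N : manifold R n)
    (M : manifold R m) (g : riemannian_metric M) (f : immersion N M)
    (c : chart R n N) (d : chart R m M) (u : 'rV[R]_n) (xi : 'rV[R]_m)
    (X : 'rV[R]_n) : 'rV[R]_n :=
  let G := ambient_metric g f c d u in
  xget 0 [set W | forall Y,
    inner G (tangent_map f c d u W) (tangent_map f c d u Y) =
    inner G (second_fundamental_form g f c d u X Y) xi].

Definition slant (R : realType) (n m : nat) (N : manifold R n)
    (M : manifold R m) (g : riemannian_metric M) (J : almost_complex M)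
    (f : immersion N M) : Prop :=
  exists theta : R, forall c d, atlas c -> atlas d ->
    forall u, local_dom f c d u -> forall X, X != 0 ->
    angle_to (ambient_metric g f c d u) (J_tangent J f c d u X)
      (tangent_space f c d u) = theta.

(* Main.v *)
(** For a plane spanned by tangent vectors E_0 and E_1, the angle between J X
    and the plane is the same for all X <> 0 in it: the square of its cosine is
    k = w ^ 2 / a, with w = <J E_0, E_1> and a the Gram determinant of E_0, E_1.
    Since the ambient connection is metric and commutes with J, the derivatives
    along X of w and a are t w + S(X) and 2 t a, with t the trace of the
    tangential part of nabla_X and
      S(X) = <h(X, E_1), F E_0> - <h(X, E_0), F E_1>,
    so the derivative of k is 2 w S(X) / a. As h is symmetric, both the
    vanishing of S and the symmetry A_{FY} X = A_{FX} Y say that <h(X, Z), F Y>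
    is totally symmetric in X, Y, Z. If S = 0, then k, which does not depend on
    the charts, is locally constant, hence constant on the connected surface.
    If k is constant, then S = 0 where w <> 0; if w vanishes somewhere, it
    vanishes identically, and S is its derivative. *)

Require Import Defs.
From mathcomp Require Import all_boot all_order all_algebra.
From mathcomp Require Import all_classical all_reals all_analysis.
From mathcomp Require Import ring lra.

Set Implicit Arguments.
Unset Strict Implicit.
Unset Printing Implicit Defensive.

Import Order.TTheory GRing.Theory Num.Theory.
Import numFieldNormedType.Exports.
Local Open Scope classical_set_scope.
Local Open Scope ring_scope.

(** * Derivatives *)

Lemma is_derive_mxP (R : realType) (V : normedModType R) m n
    (A : V -> 'M[R]_(m, n)) (dA : 'M[R]_(m, n)) a v :
  is_derive a v A dA <->
  forall i j, is_derive a v (fun z => A z i j : R) (dA i j).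
Proof.
split=> [[dr <-] i j|H].
  split; first exact: (derivable_mxP _ _ _).1.
  by rewrite derive_mx// mxE.
have dr : derivable A a v.
  by apply/derivable_mxP => i j; exact: (@ex_derive _ _ _ _ _ _ _ (H i j)).
split => //; rewrite derive_mx//; apply/matrixP => i j; rewrite mxE.
exact: (@derive_val _ _ _ _ _ _ _ (H i j)).
Qed.

Lemma is_derive_mulmx (R : realType) (V : normedModType R) m n p
    (A : V -> 'M[R]_(m, n)) (B : V -> 'M[R]_(n, p)) dA dB a v :
  is_derive a v A dA -> is_derive a v B dB ->
  is_derive a v (fun z => A z *m B z) (dA *m B a + A a *m dB).
Proof.
move=> /is_derive_mxP HA /is_derive_mxP HB; apply/is_derive_mxP => i j.
have -> : (fun z => (A z *m B z) i j : R) =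
    \sum_(k < n) ((fun z => A z i k : R) * (fun z => B z k j : R)).
  by apply/funext => z; rewrite mxE fct_sumE.
have -> : (dA *m B a + A a *m dB) i j =
    \sum_(k < n) (A a i k *: dB k j + B a k j *: dA i k : R).
  rewrite !mxE -big_split /=; apply: eq_bigr => k _.
  by rewrite addrC /GRing.scale/= (mulrC (dA i k)).
apply: (@is_derive_sum _ V R n
  (fun k => (fun z => A z i k : R) * (fun z => B z k j : R)) a v
  (fun k => A a i k *: dB k j + B a k j *: dA i k : R)) => k.
exact: is_deriveM.
Qed.

Lemma is_derive_trmx (R : realType) (V : normedModType R) m n
    (A : V -> 'M[R]_(m, n)) dA a v :
  is_derive a v A dA -> is_derive a v (fun z => (A z)^T) dA^T.
Proof.
move=> /is_derive_mxP HA; apply/is_derive_mxP => i j.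
have -> : (fun z => (A z)^T i j : R) = (fun z => A z j i : R).
  by apply/funext => z; rewrite mxE.
by rewrite mxE.
Qed.

Lemma is_derive_comp (R : realType) (U V W : normedModType R)
    (f : U -> V) (g : V -> W) a v :
  differentiable f a -> differentiable g (f a) ->
  is_derive a v (fun z => g (f z)) ('D_('d f a v) g (f a)).
Proof.
move=> df dg; have dgf := differentiable_comp df dg.
split; first exact: diff_derivable.
by rewrite deriveE//= diff_comp// deriveE.
Qed.

Lemma is_derive_line (R : realType) (V : normedModType R) (f : V -> R)
    (a v : V) (s : R) :
  derivable f (s *: v + a) v ->
  is_derive s 1 (fun t : R => f (t *: v + a) : R) ('D_v f (s *: v + a)).
Proof.
move=> df.
have H :
    (fun h : R => h^-1 *:
       ((f \o shift (s *: v + a)) (h *: v) - f (s *: v + a))) =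
    (fun h : R => h^-1 *: (((fun t : R => f (t *: v + a)) \o shift s) (h *: 1) -
        f (s *: v + a))).
  by apply/funext => h /=; rewrite [h%:A]mulr1 scalerDl addrA.
by split; rewrite /derivable /derive -H.
Qed.

(** Restricted to the line through [a], the directional derivative becomes an ordinary derivative,
    and the one-variable mean value theorem applies. *)
Lemma MVT_line (R : realType) (V : normedModType R) (f : V -> R) (a v : V)
    (t : R) : 0 < t ->
  (forall s, 0 <= s <= t -> derivable f (s *: v + a) v) ->
  exists2 s, 0 < s < t & f (t *: v + a) - f a = t * 'D_v f (s *: v + a).
Proof.
move=> t0 df.
have H s : 0 <= s <= t ->
    is_derive s 1 (fun t : R => f (t *: v + a) : R) ('D_v f (s *: v + a)).
  by move=> st; apply: is_derive_line; exact: df.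
have H' s : s \in `]0, t[%R ->
    is_derive s 1 (fun t : R => f (t *: v + a) : R) ('D_v f (s *: v + a)).
  by rewrite in_itv/= => /andP[s0 st]; apply: H; rewrite !ltW.
have cf : {within `[0, t], continuous (fun t : R => f (t *: v + a) : R)}.
  apply: derivable_within_continuous => s; rewrite in_itv/= => st.
  by have [] := H _ st.
have [s + E] := MVT t0 H' cf.
rewrite in_itv/= => st; exists s => //.
by rewrite scale0r add0r subr0 in E; rewrite E mulrC.
Qed.

(** The segment from [a] to [z] stays in the ball, so the mean value theorem along it gives a zero
    increment. *)
Lemma derive0_ball_cst (R : realType) (V : normedModType R) (f : V -> R)
    (a : V) (r : R) :
  (forall z v, ball a r z -> is_derive z v f 0) ->
  forall z, ball a r z -> f z = f a.
Proof.
move=> df z; rewrite -ball_normE/= => az.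
have inb s : 0 <= s <= 1 -> ball a r (s *: (z - a) + a).
  move=> /andP[s0 s1]; rewrite -ball_normE/= opprD addrCA subrr addr0 normrN.
  rewrite normrZ ger0_norm// distrC (le_lt_trans _ az)//.
  by rewrite ler_piMl.
have [s|s /andP[s0 s1]] := @MVT_line R V f a (z - a) 1 ltr01 _.
  by move=> /inb/df => /(_ (z - a))[].
have [_ ->] : is_derive (s *: (z - a) + a) (z - a) f 0.
  by apply/df/inb; rewrite !ltW.
by rewrite scale1r subrK mulr0 => /subr0_eq.
Qed.

(** * Symmetry of second derivatives *)

Lemma is_derive_translate (R : realType) (V W : normedModType R) (f : V -> W)
    (a b v : V) (df : W) :
  is_derive (b + a) v f df -> is_derive a v (fun z => f (b + z)) df.
Proof.
move=> [+ <-]; rewrite /derivable /derive.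
have -> : (fun h : R => h^-1 *: ((f \o shift (b + a)) (h *: v) - f (b + a))) =
          (fun h : R => h^-1 *:
            (((fun z => f (b + z)) \o shift a) (h *: v) - f (b + a))).
  by apply/funext => h /=; rewrite addrCA.
by move=> dr; split.
Qed.

(** The mean value theorem is used twice: along [v] for the increment of [f] by [t *: w], then along
    [w] for ['D_v f]. *)
Lemma second_difference (R : realType) (V : normedModType R) (f : V -> R)
    (a v w : V) (t : R) : 0 < t ->
  (forall s r, 0 <= s <= t -> 0 <= r <= t ->
     derivable f (r *: w + (s *: v + a)) v /\
     derivable ('D_v f) (r *: w + (s *: v + a)) w) ->
  exists s r, [/\ 0 <= s <= t, 0 <= r <= t &
   f (t *: w + (t *: v + a)) - f (t *: v + a) - (f (t *: w + a) - f a) =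
     t ^+ 2 * 'D_w ('D_v f) (r *: w + (s *: v + a))].
Proof.
move=> t0 H.
have t0t : 0 <= t <= t by rewrite lexx ltW.
have z0t : 0 <= (0 : R) <= t by rewrite lexx ltW.
pose g := (fun z => f (t *: w + z)) - f.
have D (s : R) : 0 <= s <= t -> is_derive (s *: v + a) v g
    ('D_v f (t *: w + (s *: v + a)) - 'D_v f (s *: v + a)).
  move=> s0t; apply: is_deriveB.
    have [dr _] := H s t s0t t0t.
    by apply: is_derive_translate; exact: derivableP.
  apply: derivableP; have [+ _] := H s 0 s0t z0t.
  by rewrite scale0r add0r.
have [s|s /andP[s0 s1] gE] := @MVT_line R V g a v t t0 _.
  by move=> /D[].
have s0t : 0 <= s <= t by rewrite !ltW.
have [r rt|r /andP[r0 r1] E] := @MVT_line R V ('D_v f) (s *: v + a) w t t0 _.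
  by have [] := H s r s0t rt.
exists s, r; split => //; first by rewrite !ltW.
have [_ gv] := D _ s0t.
by rewrite gv E mulrA -expr2 in gE.
Qed.

(** The second difference is symmetric in [v] and [w], so the two mixed derivatives take a common
    value at points arbitrarily close to [a]; continuity carries the equality to [a]. *)
Lemma derive_comm (R : realType) (V : normedModType R) (f : V -> R)
    (a v w : V) :
  (\forall z \near a, [/\ derivable f z v, derivable f z w,
     derivable ('D_v f) z w & derivable ('D_w f) z v]) ->
  {for a, continuous ('D_v ('D_w f))} -> {for a, continuous ('D_w ('D_v f))} ->
  'D_v ('D_w f) a = 'D_w ('D_v f) a.
Proof.
move=> /nbhs_ballP[/= d d0 df] c1 c2.
apply/eqP; rewrite -subr_eq0 -normr_le0; apply/ler_addgt0Pr => e e0.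
rewrite add0r.
have e20 : 0 < e / 2 by rewrite divr_gt0.
have /cvgrPdist_lt /(_ _ e20) /nbhs_ballP[/= d1 d10 H1] :
  'D_v ('D_w f) z @[z --> a] --> ('D_v ('D_w f) a : R^o) by exact: c1.
have /cvgrPdist_lt /(_ _ e20) /nbhs_ballP[/= d2 d20 H2] :
  'D_w ('D_v f) z @[z --> a] --> ('D_w ('D_v f) a : R^o) by exact: c2.
pose r0 := Num.min d (Num.min d1 d2).
have r00 : 0 < r0 by rewrite !lt_min d0 d10 d20.
(* This size keeps the whole parallelogram with sides [t *: v] and [t *: w] within [r0] of [a]; the
   summand 1 keeps the denominator positive and the bound strict. *)
pose t := r0 / (1 + `|v| + `|w|).
have k0 : 0 < 1 + `|v| + `|w| by rewrite -addrA ltr_pwDl// addr_ge0.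
have t0 : 0 < t by rewrite divr_gt0.
have inb v' w' s r : `|v'| + `|w'| = `|v| + `|w| ->
    0 <= s <= t -> 0 <= r <= t ->
    [/\ ball a d (r *: w' + (s *: v' + a)), ball a d1 (r *: w' + (s *: v' + a))
      & ball a d2 (r *: w' + (s *: v' + a))].
  move=> vw /andP[s0 st] /andP[rp rt].
  have : `|a - (r *: w' + (s *: v' + a))| < r0.
    rewrite addrA opprD addrCA subrr addr0 normrN.
    apply: le_lt_trans (ler_normD _ _) _; rewrite !normrZ !ger0_norm//.
    apply: (@le_lt_trans _ _ (t * (`|v| + `|w|))).
      by rewrite -vw addrC mulrDr lerD// ler_wpM2r.
    rewrite /t mulrAC ltr_pdivrMr// ltr_pM2l// -addrA ltrDr//.
  by rewrite !lt_min -ball_normE/= => /andP[-> /andP[-> ->]].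
have [s r rt st|s1 [r1 [sa ra E1]]] := @second_difference R V f a v w t t0 _.
  have [/df[] *] := @inb v w s r erefl rt st; by split.
have [s r rt st|s2 [r2 [sb rb E2]]] := @second_difference R V f a w v t t0 _.
  have [/df[] *] := @inb w v s r (addrC _ _) rt st; by split.
have E : 'D_w ('D_v f) (r1 *: w + (s1 *: v + a)) =
         'D_v ('D_w f) (r2 *: v + (s2 *: w + a)).
  apply: (@mulfI _ (t ^+ 2)); first by rewrite expf_neq0// gt_eqF.
  apply: etrans (esym E1) (etrans _ E2).
  have -> : t *: v + (t *: w + a) = t *: w + (t *: v + a) by rewrite addrCA.
  ring.
have [_ _ /H2 B2] := @inb v w _ _ erefl sa ra.
have [_ /H1 B1 _] := @inb w v _ _ (addrC _ _) sb rb.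
rewrite (splitr e) -(subrKA ('D_v ('D_w f) (r2 *: v + (s2 *: w + a)))).
apply: le_trans (ler_normD _ _) _; apply: lerD; apply/ltW; first exact: B1.
by rewrite distrC -E; exact: B2.
Qed.

(** Reduces to [derive_comm] on each coordinate; [Ck 2] supplies the continuity of the second
    directional derivatives. *)
Lemma Ck2_derive_comm (R : realType) (V : normedModType R) m (U : set V)
    (f : V -> 'rV[R]_m) (a v w : V) : open U -> Ck 2 U f -> U a ->
  'D_v ('D_w f) a = 'D_w ('D_v f) a.
Proof.
move=> oU [df ddf] Ua.
have nU z : U z -> \forall z \near z, U z by move=> Uz; exact: open_nbhs_nbhs.
have d1 z x : U z -> derivable f z x by move=> Uz; exact/diff_derivable/df.
have d2 z x x' : U z -> derivable ('D_x f) z x'.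
  by move=> Uz; apply: diff_derivable; exact: (ddf x).1.
have E1 j x z : U z -> 'D_x (fun z => f z 0 j : R) z = ('D_x f) z 0 j.
  by move=> Uz; rewrite derive_mx ?mxE//; exact: d1.
have E2 j x x' z : U z ->
    'D_x ('D_x' (fun z => f z 0 j : R)) z = 'D_x ('D_x' f) z 0 j.
  move=> Uz; rewrite derive_mx ?mxE; last exact: d2.
  by apply: near_eq_derive; apply: filterS (nU _ Uz) => z' /E1.
have cE j x x' : {for a, continuous ('D_x ('D_x' (fun z => f z 0 j : R)))}.
  have c : 'D_x ('D_x' f) z 0 j @[z --> a] --> ('D_x ('D_x' f) a 0 j : R^o).
    have : {for a, continuous ('D_x ('D_x' f))} by exact: (ddf x').2.
    by move=> cx; exact: (continuous_comp cx (@coord_continuous R 1 m 0 j _)).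
  rewrite /continuous_at /prop_for E2//; apply: cvg_trans c.
  by apply: near_eq_cvg; apply: filterS (nU _ Ua) => z /E2 ->.
apply/rowP => j.
apply: etrans (esym (E2 j v w a Ua)) (etrans _ (E2 j w v a Ua)).
apply: derive_comm; [|exact: cE|exact: cE].
apply: filterS (nU _ Ua) => z Uz.
have D x : derivable (fun z => f z 0 j : R) z x.
  by have /derivable_mxP := d1 z x Uz; apply.
have DD x x' : derivable ('D_x (fun z => f z 0 j : R)) z x'.
  apply: (@near_eq_derivable _ _ _ (fun z => 'D_x f z 0 j : R)).
    by apply: filterS (nU _ Uz) => z' /E1 ->.
  by have /derivable_mxP := d2 z x x' Uz; apply.
by split.
Qed.

(** Chain rule along both sides of a square of maps commuting near [u]. Vectors are rows, so the
    Jacobian of the map applied first stands on the left. *)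
Lemma jacobian_square (R : realType) (n n' m m' : nat)
    (f : 'rV[R]_n -> 'rV[R]_m) (s : 'rV[R]_m -> 'rV[R]_m')
    (t : 'rV[R]_n -> 'rV[R]_n') (h : 'rV[R]_n' -> 'rV[R]_m') u :
  differentiable f u -> differentiable s (f u) ->
  differentiable t u -> differentiable h (t u) ->
  (\forall z \near u, h (t z) = s (f z)) ->
  jacobian t u *m jacobian h (t u) = jacobian f u *m jacobian s (f u).
Proof.
move=> df ds dt dh E; apply/row_matrixP => i; rewrite !rowE !mulmxA.
rewrite !mul_rV_lin1.
have [_ E1] := is_derive_comp (delta_mx 0 i) dt dh.
have [_ E2] := is_derive_comp (delta_mx 0 i) df ds.
rewrite -(deriveE _ dh) -(deriveE _ ds) -E1 -E2.
exact: near_eq_derive.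
Qed.

(** * Inner products *)

(** Phrased through the form [inner G], as [metric_sym] and [metric_pos] provide it. *)
Definition spd (R : realType) (n : nat) (G : 'M[R]_n) : Prop :=
  (forall v w, inner G v w = inner G w v) /\
  (forall v, v != 0 -> 0 < inner G v v).

Section inner.
Context {R : realType} {n : nat}.
Implicit Types (G : 'M[R]_n) (v w x : 'rV[R]_n).

Lemma innerDl G v w x : inner G (v + w) x = inner G v x + inner G w x.
Proof. by rewrite /inner !mulmxDl mxE. Qed.

Lemma innerDr G v w x : inner G x (v + w) = inner G x v + inner G x w.
Proof. by rewrite /inner linearD mulmxDr mxE. Qed.

Lemma innerZl G (k : R) v w : inner G (k *: v) w = k * inner G v w.
Proof. by rewrite /inner -!scalemxAl mxE. Qed.

Lemma innerZr G (k : R) v w : inner G v (k *: w) = k * inner G v w.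
Proof. by rewrite /inner linearZ -scalemxAr mxE. Qed.

Lemma innerNl G v w : inner G (- v) w = - inner G v w.
Proof. by rewrite -scaleN1r innerZl mulN1r. Qed.

Lemma innerNr G v w : inner G v (- w) = - inner G v w.
Proof. by rewrite -scaleN1r innerZr mulN1r. Qed.

Lemma inner0l G v : inner G 0 v = 0.
Proof. by rewrite -(scale0r 0) innerZl mul0r. Qed.

Lemma innerBl G v w x : inner G (v - w) x = inner G v x - inner G w x.
Proof. by rewrite innerDl innerNl. Qed.

Lemma inner_delta G i j : inner G (delta_mx 0 i) (delta_mx 0 j) = G i j.
Proof. by rewrite /inner trmx_delta -rowE -colE !mxE. Qed.

Lemma inner_pullback m (L : 'M[R]_(m, n)) G (v w : 'rV[R]_m) :
  inner G (v *m L) (w *m L) = inner (L *m G *m L^T) v w.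
Proof. by rewrite /inner trmx_mul !mulmxA. Qed.

Lemma spd_sym G : spd G -> G^T = G.
Proof.
by move=> [Gs _]; apply/matrixP => i j; rewrite mxE -!inner_delta Gs.
Qed.

Lemma spd_unit G : spd G -> G \in unitmx.
Proof.
move=> [_ Gp]; rewrite -row_free_unit; apply: inj_row_free => v vG.
apply/eqP/negPn/negP => /Gp.
by rewrite /inner vG mul0mx mxE ltxx.
Qed.

Lemma spd_eq0 G v : spd G -> inner G v v = 0 -> v = 0.
Proof.
by move=> [_ Gp] v0; apply/eqP/negPn/negP => /Gp; rewrite v0 ltxx.
Qed.

Lemma spd_pullback m (L : 'M[R]_(m, n)) G :
  row_free L -> spd G -> spd (L *m G *m L^T).
Proof.
move=> Lf [Gs Gp]; split=> [v w|v v0]; rewrite -!inner_pullback//.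
apply: Gp; apply: contra_neq v0 => vL; apply: (row_free_inj Lf).
by rewrite mul0mx.
Qed.

Lemma cauchy_schwarz G v w : spd G ->
  inner G v w ^+ 2 <= inner G v v * inner G w w.
Proof.
move=> sG; have [->|w0] := eqVneq w 0.
  by rewrite sG.1 !inner0l mulr0 expr0n.
have ww := sG.2 _ w0.
(* A multiple of the component of [v] orthogonal to [w]; its square norm is the defect in the
   inequality, up to the factor [inner G w w]. *)
pose x := inner G w w *: v - inner G v w *: w.
have xx : inner G x x =
    inner G w w * (inner G v v * inner G w w - inner G v w ^+ 2).
  by rewrite !(innerBl, innerDr, innerNr, innerZl, innerZr) (sG.1 w v); ring.
have : 0 <= inner G x x.
  have [->|x0] := eqVneq x 0; first by rewrite inner0l.
  exact/ltW/sG.2.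
by rewrite xx pmulr_rge0// subr_ge0.
Qed.

End inner.

(** * Orthogonal projection onto a row space *)

Section tangential_projection.
Context {R : realType} {n m : nat}.
Variables (G : 'M[R]_m) (L : 'M[R]_(n, m)).
Hypotheses (sG : spd G) (Lf : row_free L).

(** The solution of the normal equations for the row space of [L], as a matrix acting on row vectors
    from the right. *)
Definition tproj : 'M[R]_m := G *m L^T *m invmx (L *m G *m L^T) *m L.

Lemma tproj_orth v (w : 'rV[R]_n) : inner G (v - v *m tproj) (w *m L) = 0.
Proof.
have U := spd_unit (spd_pullback Lf sG).
rewrite innerBl /inner trmx_mul /tproj !mulmxA.
rewrite -[_ *m L *m G]mulmxA -[_ *m (L *m G) *m L^T]mulmxA mulmxKV//.
by rewrite subrr.
Qed.

(** The vector chosen in [tangential] is unique: the difference of two candidates lies in the row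
    space and is orthogonal to it, hence is zero. *)
Lemma normal_tproj v :
  normal G (range (fun X : 'rV[R]_n => X *m L)) v = v - v *m tproj.
Proof.
rewrite /normal /tangential; congr (_ - _); apply: xget_unique.
  split; first by exists (v *m (G *m L^T *m invmx (L *m G *m L^T)));
    rewrite ?/tproj ?mulmxA.
  by move=> _ [w _ <-]; exact: tproj_orth.
move=> _ [[y _ <-] yo].
have yE : v *m tproj = v *m (G *m L^T *m invmx (L *m G *m L^T)) *m L.
  by rewrite /tproj !mulmxA.
apply/subr0_eq/(spd_eq0 sG).
rewrite {2}yE -mulmxBl.
have /= := yo ((y - v *m (G *m L^T *m invmx (L *m G *m L^T))) *m L) _.
rewrite innerBl => /(_ (ex_intro2 _ _ _ I erefl)) H1.
have := tproj_orth v (y - v *m (G *m L^T *m invmx (L *m G *m L^T))).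
by rewrite !innerBl => H2; lra.
Qed.

End tangential_projection.

(** * Linear algebra in dimension two *)

Lemma row2E (R : realType) (v : 'rV[R]_2) :
  v = v 0 0 *: delta_mx 0 0 + v 0 1 *: delta_mx 0 1.
Proof.
rewrite {1}[v]row_sum_delta big_ord_recl big_ord1.
by have -> : lift 0 (0 : 'I_1) = 1 :> 'I_2 by apply/val_inj.
Qed.

Lemma row2K (R : realType) (a b : R) :
  let v : 'rV[R]_2 := a *: delta_mx 0 0 + b *: delta_mx 0 1 in
  (v 0 0 = a) * (v 0 1 = b).
Proof. by rewrite /= !mxE/= !mulr1 !mulr0 addr0 add0r. Qed.

Lemma delta2 (R : realType) : ((delta_mx 0 0 : 'rV[R]_2) 0 0 = 1) *
  ((delta_mx 0 0 : 'rV[R]_2) 0 1 = 0) * ((delta_mx 0 1 : 'rV[R]_2) 0 0 = 0) *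
  ((delta_mx 0 1 : 'rV[R]_2) 0 1 = 1).
Proof. by rewrite !mxE. Qed.

Lemma inner2E (R : realType) (A : 'M[R]_2) (v w : 'rV[R]_2) :
  inner A v w = A 0 0 * v 0 0 * w 0 0 + A 0 1 * v 0 0 * w 0 1 +
                A 1 0 * v 0 1 * w 0 0 + A 1 1 * v 0 1 * w 0 1.
Proof.
rewrite {1}[v]row2E {1}[w]row2E !(innerDl, innerDr, innerZl, innerZr).
by rewrite !inner_delta; ring.
Qed.

Lemma det2E (R : realType) (A : 'M[R]_2) :
  \det A = A 0 0 * A 1 1 - A 0 1 * A 1 0.
Proof.
rewrite (expand_det_row _ 0) big_ord_recl big_ord1 /cofactor !det_mx11 !mxE.
have -> : lift 0 (0 : 'I_1) = 1 :> 'I_2 by apply/val_inj.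
have -> : lift 1 (0 : 'I_1) = 0 :> 'I_2 by apply/val_inj.
by rewrite expr0 expr1; ring.
Qed.

Lemma le_acos (R : realType) (x y : R) : -1 <= x -> x <= y -> y <= 1 ->
  acos y <= acos x.
Proof.
move=> x1 xy y1.
have Hx : -1 <= x <= 1 by rewrite x1 (le_trans xy).
have Hy : -1 <= y <= 1 by rewrite y1 (le_trans x1).
rewrite leNgt -ltr_cos ?in_itv/= ?acos_ge0 ?acos_lepi//.
by rewrite !acosK ?in_itv//= -leNgt.
Qed.

Lemma bilinear2_sym (R : realType) (b : 'rV[R]_2 -> 'rV[R]_2 -> R) :
  (forall x x' y, b (x + x') y = b x y + b x' y) ->
  (forall k x y, b (k *: x) y = k * b x y) ->
  (forall x y y', b x (y + y') = b x y + b x y') ->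
  (forall k x y, b x (k *: y) = k * b x y) ->
  b (delta_mx 0 0) (delta_mx 0 1) = b (delta_mx 0 1) (delta_mx 0 0) ->
  forall x y, b x y = b y x.
Proof.
move=> Dl Zl Dr Zr b01 x y.
by rewrite [x]row2E [y]row2E !(Dl, Zl, Dr, Zr) b01; ring.
Qed.

Lemma spd_inner_inj (R : realType) m (G : 'M[R]_m) v w : spd G ->
  (forall x, inner G v x = inner G w x) -> v = w.
Proof.
move=> sG vw; apply/subr0_eq/(spd_eq0 sG).
by rewrite innerBl vw subrr.
Qed.

(** Gives the existence of the Weingarten map: the row of values of [l] on the basis, times the
    inverse of [A], represents [l]. *)
Lemma riesz2 (R : realType) (A : 'M[R]_2) (l : 'rV[R]_2 -> R) : spd A ->
  (forall x y, l (x + y) = l x + l y) -> (forall k x, l (k *: x) = k * l x) ->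
  exists w, forall x, inner A w x = l x.
Proof.
move=> sA lD lZ.
pose b : 'rV[R]_2 :=
  l (delta_mx 0 0) *: delta_mx 0 0 + l (delta_mx 0 1) *: delta_mx 0 1.
exists (b *m invmx A) => x; rewrite /inner mulmxKV ?spd_unit//.
rewrite [x in RHS]row2E lD !lZ !mxE big_ord_recl big_ord1.
have -> : lift 0 (0 : 'I_1) = 1 :> 'I_2 by apply/val_inj.
by rewrite !row2K !mxE; ring.
Qed.

(** * The angle between J X and a plane *)

(* The squared cosine of the Wirtinger angle of the plane spanned by the rows
   of [L]. *)
Definition wirtinger (R : realType) (m : nat) (G J : 'M[R]_m)
    (L : 'M[R]_(2, m)) : R :=
  \det (L *m (J *m G) *m L^T) / \det (L *m G *m L^T).

Section hermitian.
Context {R : realType} {m : nat}.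
Variables (G J : 'M[R]_m).
Hypotheses (sG : spd G) (JJ : J *m J = - 1%:M)
  (JG : forall v w, inner G (v *m J) (w *m J) = inner G v w).

(** Applying the isometry [J] to both arguments turns [v *m J] into [- v]. *)
Lemma inner_J_skew v w : inner G (v *m J) w = - inner G v (w *m J).
Proof. by rewrite -JG -mulmxA JJ mulmxN mulmx1 innerNl. Qed.

Lemma inner_J_alt v : inner G (v *m J) v = 0.
Proof. by have := inner_J_skew v v; rewrite (sG.1 v); lra. Qed.

End hermitian.

(** The form takes the value [A 0 0 * \det A] at the vector with components [- A 0 1] and [A 0 0],
    which is orthogonal to the first basis vector. *)
Lemma spd_det2_gt0 (R : realType) (A : 'M[R]_2) : spd A -> 0 < \det A.
Proof.
move=> sA; have A01 : A 0 1 = A 1 0 by rewrite -{1}(spd_sym sA) mxE.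
have A00 : 0 < A 0 0.
  rewrite -inner_delta; apply: sA.2.
  by apply/eqP => /matrixP/(_ 0 0)/eqP; rewrite !mxE oner_eq0.
have := sA.2 (- A 0 1 *: delta_mx 0 0 + A 0 0 *: delta_mx 0 1).
have -> : (- A 0 1 *: delta_mx 0 0 + A 0 0 *: delta_mx 0 1 : 'rV[R]_2) != 0.
  apply/eqP => /matrixP/(_ 0 1)/eqP; rewrite !mxE /= mulr0 mulr1 add0r.
  by rewrite gt_eqF.
move=> /(_ isT); rewrite inner2E !mxE/= det2E A01 => H.
rewrite -(pmulr_rgt0 _ A00).
suff E : A 0 0 * (A 0 0 * A 1 1 - A 1 0 * A 1 0) =
    A 0 0 * (- A 1 0 * 1 + A 0 0 * 0) * (- A 1 0 * 1 + A 0 0 * 0) +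
    A 1 0 * (- A 1 0 * 1 + A 0 0 * 0) * (- A 1 0 * 0 + A 0 0 * 1) +
    A 1 0 * (- A 1 0 * 0 + A 0 0 * 1) * (- A 1 0 * 1 + A 0 0 * 0) +
    A 1 1 * (- A 1 0 * 0 + A 0 0 * 1) * (- A 1 0 * 0 + A 0 0 * 1).
  by rewrite E.
ring.
Qed.

Lemma inner_mulJ (R : realType) m (J G : 'M[R]_m) v w :
  inner (J *m G) v w = inner G (v *m J) w.
Proof. by rewrite /inner mulmxA. Qed.

Section angle.
Context {R : realType} {m : nat}.
Variables (G J : 'M[R]_m) (L : 'M[R]_(2, m)).
Hypotheses (sG : spd G) (JJ : J *m J = - 1%:M)
  (JG : forall v w, inner G (v *m J) (w *m J) = inner G v w)
  (Lf : row_free L).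
Let A := L *m G *m L^T.
Let B := L *m (J *m G) *m L^T.
Let w := B 0 1.

(** The form is alternating on a plane, hence a multiple of the determinant; [w] is its value on the
    basis. *)
Lemma pullback_J v v' :
  inner G (v *m L *m J) (v' *m L) = w * (v 0 0 * v' 0 1 - v 0 1 * v' 0 0).
Proof.
have BE i j : B i j = inner G (delta_mx 0 i *m L *m J) (delta_mx 0 j *m L).
  by rewrite -inner_mulJ inner_pullback inner_delta.
have B0 i : B i i = 0 by rewrite BE (inner_J_alt sG).
have B1 : B 1 0 = - w by rewrite /w !BE (inner_J_skew JJ)// sG.1.
by rewrite -inner_mulJ inner_pullback inner2E -/B !B0 B1 /w; ring.
Qed.

Lemma wirtingerE : wirtinger G J L = w ^+ 2 / \det A.
Proof.
have BE i j : B i j = inner G (delta_mx 0 i *m L *m J) (delta_mx 0 j *m L).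
  by rewrite -inner_mulJ inner_pullback inner_delta.
have B00 : B 0 0 = 0 by rewrite BE pullback_J !delta2; ring.
have B10 : B 1 0 = - w by rewrite BE pullback_J !delta2; ring.
by rewrite /wirtinger det2E -/B B00 B10 -/A -/w; congr (_ / _); ring.
Qed.

Lemma wirtinger_itv : 0 <= wirtinger G J L <= 1.
Proof.
have sA : spd A := spd_pullback Lf sG.
have dA := spd_det2_gt0 sA.
rewrite wirtingerE; apply/andP; split.
  by apply: divr_ge0; [exact: sqr_ge0|exact: ltW].
rewrite ler_pdivrMr// mul1r.
have A01 : A 0 1 = A 1 0 by rewrite -{1}(spd_sym sA) mxE.
have A00 : 0 < A 0 0.
  rewrite -inner_delta; apply: sA.2.
  by apply/eqP => /matrixP/(_ 0 0)/eqP; rewrite !mxE oner_eq0.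
(* This vector is [A]-orthogonal to the first basis vector, so Cauchy-Schwarz between it and [J] of
   that basis vector yields exactly [w ^+ 2 <= \det A]. *)
pose x : 'rV[R]_2 := - A 0 1 *: delta_mx 0 0 + A 0 0 *: delta_mx 0 1.
have := cauchy_schwarz (delta_mx 0 0 *m L *m J) (x *m L) sG.
rewrite pullback_J JG !inner_pullback -/A inner_delta inner2E det2E /x.
rewrite !row2K !delta2 A01.
move=> H; rewrite -(ler_pM2l (exprn_gt0 2 A00)) -subr_ge0.
by move: H; rewrite -subr_ge0; congr (_ <= _); ring.
Qed.

Lemma gnorm_J (v : 'rV[R]_2) :
  Defs.gnorm G (v *m L *m J) = Num.sqrt (inner A v v).
Proof. by rewrite /Defs.gnorm JG inner_pullback. Qed.

(** Lagrange's identity: the Gram determinant of [v] and [v'] is the squared area they span. *)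
Lemma gram_identity (v v' : 'rV[R]_2) :
  (v 0 0 * v' 0 1 - v 0 1 * v' 0 0) ^+ 2 * \det A + inner A v v' ^+ 2 =
  inner A v v * inner A v' v'.
Proof.
have sA : spd A := spd_pullback Lf sG.
have A01 : A 0 1 = A 1 0 by rewrite -{1}(spd_sym sA) mxE.
by rewrite !inner2E det2E A01; ring.
Qed.

(* The vector of the plane closest to [J X] is orthogonal to [X]. *)
Lemma angle_toE (v : 'rV[R]_2) : v != 0 ->
  angle_to G (v *m L *m J) (range (fun X : 'rV[R]_2 => X *m L)) =
  acos (Num.sqrt (wirtinger G J L)).
Proof.
move=> v0; have sA : spd A := spd_pullback Lf sG.
have dA := spd_det2_gt0 sA.
have pv := sA.2 _ v0.
have nL (x : 'rV[R]_2) : x *m L != 0 -> x != 0.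
  by apply: contra_neq => ->; rewrite mul0mx.
pose k := Num.sqrt (wirtinger G J L).
(* [c v'] is the cosine of the angle between [J X] and [v' *m L]; the aim is to show that its
   maximum is [k]. *)
pose c (v' : 'rV[R]_2) := w * (v 0 0 * v' 0 1 - v 0 1 * v' 0 0) /
   (Num.sqrt (inner A v v) * Num.sqrt (inner A v' v')).
have angE (v' : 'rV[R]_2) : angle G (v *m L *m J) (v' *m L) = acos (c v').
  by rewrite /angle gnorm_J pullback_J /Defs.gnorm inner_pullback.
have cB (v' : 'rV[R]_2) : v' != 0 -> `|c v'| <= k.
  move=> v'0; have pv' := sA.2 _ v'0.
  rewrite -sqrtr_sqr ler_wsqrtr// wirtingerE /c expr_div_n !exprMn.
  rewrite (sqr_sqrtr (ltW pv)) (sqr_sqrtr (ltW pv')) -gram_identity.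
  rewrite ler_pdivrMr; last by rewrite gram_identity mulr_gt0.
  rewrite [leRHS]mulrAC ler_pdivlMr//.
  rewrite -mulrA; apply: ler_wpM2l; first exact: sqr_ge0.
  by rewrite lerDl sqr_ge0.
(* Needed to stay in the interval [-1, 1], where [acos] is decreasing. *)
have c1 (v' : 'rV[R]_2) : v' != 0 -> `|c v'| <= 1.
  move=> v'0; have pv' := sA.2 _ v'0.
  rewrite -sqrtr_sqr -[leRHS]sqrtr1 ler_wsqrtr// /c expr_div_n.
  rewrite [(Num.sqrt _ * _) ^+ 2]exprMn.
  rewrite (sqr_sqrtr (ltW pv)) (sqr_sqrtr (ltW pv')).
  rewrite ler_pdivrMr ?mulr_gt0// mul1r -pullback_J.
  by rewrite (le_trans (cauchy_schwarz _ _ sG))// JG !inner_pullback.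
have [v' v'0 ck] : exists2 v', v' != 0 & c v' = k.
  (* The sign of [w], chosen so that the cosine at the extremal vector is [k] and not [- k]. *)
  pose s : R := if 0 <= w then 1 else -1.
  have ss : s ^+ 2 = 1 by rewrite /s; case: ifP; rewrite ?sqrrN expr1n.
  have sw : s * w = `|w|.
    rewrite /s; case: ifPn => [w0|]; first by rewrite mul1r ger0_norm.
    by rewrite -ltNge => w0; rewrite mulN1r ltr0_norm.
  (* [v] turned by a right angle in the metric [A], up to scale; this makes the second square in
     [gram_identity] vanish. *)
  pose y : 'rV[R]_2 := (- (A 0 1 * v 0 0 + A 1 1 * v 0 1)) *: delta_mx 0 0 +
                  (A 0 0 * v 0 0 + A 0 1 * v 0 1) *: delta_mx 0 1.
  pose x := s *: y.
  have [y0 y1] : y 0 0 = - (A 0 1 * v 0 0 + A 1 1 * v 0 1) /\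
    y 0 1 = A 0 0 * v 0 0 + A 0 1 * v 0 1 by rewrite /y !row2K.
  have A01 : A 1 0 = A 0 1 by rewrite -{1}(spd_sym sA) mxE.
  have dx : v 0 0 * x 0 1 - v 0 1 * x 0 0 = s * inner A v v.
    by rewrite /x ![(s *: y) _ _]mxE y0 y1 inner2E A01; ring.
  have xx : inner A x x = \det A * inner A v v.
    rewrite /x innerZl innerZr mulrA -expr2 ss mul1r.
    by rewrite !inner2E y0 y1 det2E A01; ring.
  have x0 : x != 0.
    apply/eqP => E; move: xx; rewrite E inner0l => /esym/eqP.
    by rewrite gt_eqF ?mulr_gt0.
  exists x => //; rewrite /c dx xx mulrA (mulrC w) sw.
  rewrite sqrtrM ?ltW// mulrCA -expr2 sqr_sqrtr ?ltW// /k wirtingerE.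
  rewrite sqrtrM ?sqr_ge0// sqrtr_sqr sqrtrV ?ltW//.
  by rewrite -mulf_div mulfV ?mulr1// gt_eqF.
have k1 : k <= 1.
  by rewrite -[leRHS]sqrtr1 ler_wsqrtr//; have /andP[] := wirtinger_itv.
have N0 : v' *m L != 0.
  by apply: contra_neq v'0 => E; apply: (row_free_inj Lf); rewrite mul0mx.
have lb : lbound [set angle G (v *m L *m J) y | y in
    [set y | (range (fun X : 'rV[R]_2 => X *m L)) y /\ y != 0]] (acos k).
  move=> _ [_ [[y _ <-] /nL y0] <-]; rewrite angE.
  have := cB y y0; have := c1 y y0.
  rewrite !ler_norml => /andP[a1 a2] /andP[_ a4].
  exact: le_acos.
apply/eqP; rewrite eq_le; apply/andP; split.
  apply: ge_inf; first by exists (acos k).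
  by exists (v' *m L); [split => //; exists v'|rewrite angE ck].
apply: lb_le_inf => //.
by exists (acos k), (v' *m L); [split => //; exists v'|rewrite angE ck].
Qed.

End angle.

(** A change of ambient coordinates [T] preserves both matrices in the quotient, and a change of
    frame [A] multiplies both determinants by the square of [\det A]. *)
Lemma wirtinger_pullback (R : realType) m m' (G J : 'M[R]_m) (G' J' : 'M[R]_m')
    (L : 'M[R]_(2, m)) (L' : 'M[R]_(2, m')) (A : 'M[R]_2) (T : 'M[R]_(m, m')) :
  spd G -> row_free L -> A *m L' = L *m T -> G = T *m G' *m T^T ->
  J *m T = T *m J' -> wirtinger G J L = wirtinger G' J' L'.
Proof.
move=> sG Lf AL GT JT.
have E1 : L *m G *m L^T = A *m (L' *m G' *m L'^T) *m A^T.
  transitivity ((L *m T) *m G' *m (L *m T)^T).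
    by rewrite GT trmx_mul !mulmxA.
  by rewrite -AL trmx_mul !mulmxA.
have E2 : L *m (J *m G) *m L^T = A *m (L' *m (J' *m G') *m L'^T) *m A^T.
  transitivity ((L *m T) *m (J' *m G') *m (L *m T)^T).
    by rewrite GT trmx_mul !mulmxA -(mulmxA L J T) JT !mulmxA.
  by rewrite -AL trmx_mul !mulmxA.
have := spd_det2_gt0 (spd_pullback Lf sG).
rewrite /wirtinger E1 E2 !(det_mulmx (A *m _)) !(det_mulmx A) det_tr.
move: (\det A) (\det (L' *m G' *m _)) (\det (L' *m _ *m _)) => a q b H.
(* Positivity of the Gram determinant of [L], which factors as [a * q * a], forces [A] to be
   invertible. *)
have a0 : a != 0 by apply/eqP => a0; move: H; rewrite a0 !mul0r ltxx.
have q0 : q != 0 by apply/eqP => q0; move: H; rewrite q0 mulr0 mul0r ltxx.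
by field; rewrite a0 q0.
Qed.

(** * The Levi-Civita connection along a map *)

Section christoffel.
Context {R : realType} {m : nat}.
Variables (G : 'rV[R]_m -> 'M[R]_m) (y : 'rV[R]_m).
Hypotheses (sG : spd (G y)) (dG : differentiable G y)
  (Gs : \forall z \near y, (G z)^T = G z).

Lemma diff_metric_sym v w x : inner ('d G y v) w x = inner ('d G y v) x w.
Proof.
have H : ('d G y v)^T = 'd G y v.
  rewrite -!deriveE//.
  have D : is_derive y v G ('D_v G y) by exact/derivableP/diff_derivable.
  have [_ <-] := is_derive_trmx D.
  by apply: near_eq_derive; apply: filterS Gs => z ->.
have -> : inner ('d G y v) w x = (w *m 'd G y v *m x^T)^T 0 0.
  by rewrite [RHS]mxE.
by rewrite !trmx_mul trmxK H mulmxA.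
Qed.

Lemma inner_diff_metric v w x :
  inner ('d G y v) w x = \sum_i \sum_j \sum_l
    'd G y (delta_mx 0 i) j l * v 0 i * w 0 j * x 0 l.
Proof.
rewrite {1}[v]row_sum_delta linear_sum /=.
transitivity (\sum_i inner ('d G y (v 0 i *: delta_mx 0 i)) w x).
  by rewrite /inner mulmx_sumr mulmx_suml summxE.
apply: eq_bigr => i _; rewrite linearZ /= /inner !mxE.
rewrite exchange_big /=; apply: eq_bigr => l _.
rewrite !mxE mulr_suml; apply: eq_bigr => j _; rewrite !mxE; ring.
Qed.

(** The Koszul formula for fields with constant components. Torsion-freeness and compatibility with
    the metric are read off from it. *)
Lemma inner_Gamma v w x : inner (G y) (Gamma G y v w) x =
  2^-1 * (inner ('d G y v) w x + inner ('d G y w) v x - inner ('d G y x) v w).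
Proof.
(* The Christoffel symbols of the first kind contracted with [v] and [w]; pairing with [G y] cancels
   the inverse metric. *)
pose K := \row_l \sum_i \sum_j 2^-1 * ('d G y (delta_mx 0 i) j l +
  'd G y (delta_mx 0 j) i l - 'd G y (delta_mx 0 l) i j) * v 0 i * w 0 j.
have GE : Gamma G y v w = K *m invmx (G y).
  have is_sym : (invmx (G y))^T = invmx (G y) by rewrite trmx_inv (spd_sym sG).
  apply/rowP => k; rewrite !mxE.
  under [RHS]eq_bigr do rewrite !mxE mulr_suml.
  rewrite [RHS]exchange_big /=; apply: eq_bigr => i _.
  under [RHS]eq_bigr do rewrite mulr_suml.
  rewrite [RHS]exchange_big /=; apply: eq_bigr => j _.
  rewrite /christoffel mulr_sumr !mulr_suml; apply: eq_bigr => l _.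
  have E a b c : 'D_(delta_mx 0 a : 'rV[R]_m) (fun z => G z b c : R^o) y =
      'd G y (delta_mx 0 a) b c.
    rewrite -deriveE// derive_mx ?mxE//; exact: diff_derivable.
  have invs : invmx (G y) l k = invmx (G y) k l by rewrite -{1}is_sym mxE.
  by rewrite !E invs; ring.
have -> : inner (G y) (Gamma G y v w) x = (K *m x^T) 0 0.
  by rewrite /inner GE mulmxKV// spd_unit.
pose D i := 'd G y (delta_mx 0 i).
have -> : inner ('d G y w) v x =
    \sum_i \sum_j \sum_l D j i l * w 0 j * v 0 i * x 0 l.
  by rewrite inner_diff_metric exchange_big.
have -> : inner ('d G y x) v w =
    \sum_i \sum_j \sum_l D l i j * x 0 l * v 0 i * w 0 j.
  rewrite inner_diff_metric exchange_big /=; apply: eq_bigr => i _.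
  by rewrite exchange_big.
rewrite inner_diff_metric mxE.
transitivity (\sum_i \sum_j \sum_l
   (2^-1 * (D i j l + D j i l - D l i j) * v 0 i * w 0 j * x 0 l)).
  under eq_bigr => l _.
    rewrite !mxE mulr_suml.
    under eq_bigr do rewrite mulr_suml.
    over.
  rewrite exchange_big /=; apply: eq_bigr => i _.
  by rewrite exchange_big.
rewrite -!big_split -sumrN -big_split mulr_sumr /=; apply: eq_bigr => i _.
rewrite -!big_split -sumrN -big_split mulr_sumr /=; apply: eq_bigr => j _.
rewrite -!big_split -sumrN -big_split mulr_sumr /=; apply: eq_bigr => l _.
by rewrite /D; ring.
Qed.

Lemma Gamma_sym v w : Gamma G y v w = Gamma G y w v.
Proof.
apply: (spd_inner_inj sG) => x; rewrite !inner_Gamma.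
by rewrite (diff_metric_sym x v w); ring.
Qed.

Lemma GammaDr v w w' : Gamma G y v (w + w') = Gamma G y v w + Gamma G y v w'.
Proof.
apply: (spd_inner_inj sG) => x; rewrite innerDl !inner_Gamma linearD.
rewrite !(innerDl, innerDr).
have -> : inner ('d G y w + 'd G y w') v x =
    inner ('d G y w) v x + inner ('d G y w') v x.
  by rewrite /inner mulmxDr mulmxDl mxE.
ring.
Qed.

Lemma GammaZr v (k : R) w : Gamma G y v (k *: w) = k *: Gamma G y v w.
Proof.
apply: (spd_inner_inj sG) => x; rewrite innerZl !inner_Gamma linearZ /=.
rewrite !(innerZl, innerZr).
have -> : inner (k *: 'd G y w) v x = k * inner ('d G y w) v x.
  by rewrite /inner -scalemxAr -scalemxAl mxE.
ring.
Qed.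

(** In the sum of the two Koszul formulas only the derivative of the metric along [v] survives. *)
Lemma Gamma_metric v w x :
  inner (G y) (Gamma G y v w) x + inner (G y) w (Gamma G y v x) =
  inner ('d G y v) w x.
Proof.
rewrite (sG.1 w) !inner_Gamma (diff_metric_sym v x w).
by rewrite (diff_metric_sym x v w) (diff_metric_sym w v x); field.
Qed.

End christoffel.

Section along.
Context {R : realType} {n m : nat}.
Variables (G : 'rV[R]_m -> 'M[R]_m) (f : 'rV[R]_n -> 'rV[R]_m) (u : 'rV[R]_n).
Hypotheses (sG : spd (G (f u))) (dG : differentiable G (f u))
  (Gs : \forall z \near f u, (G z)^T = G z) (df : differentiable f u).
Implicit Types V W : 'rV[R]_n -> 'rV[R]_m.

Lemma is_derive_inner V W X : derivable V u X -> derivable W u X ->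
  is_derive u X (fun z => inner (G (f z)) (V z) (W z) : R)
    (inner (G (f u)) (covd G f V X u) (W u) +
     inner (G (f u)) (V u) (covd G f W X u)).
Proof.
move=> /derivableP dV /derivableP dW.
have /is_derive_mxP/(_ 0 0) D := is_derive_mulmx
  (is_derive_mulmx dV (is_derive_comp X df dG)) (is_derive_trmx dW).
apply: (is_derive_eq D); rewrite (deriveE _ dG) /covd innerDl innerDr.
have add00 (A B : 'M[R]_1) : (A + B) 0 0 = A 0 0 + B 0 0 by rewrite mxE.
rewrite !mulmxDl !add00.
have := Gamma_metric sG dG Gs ('d f u X) (V u) (W u).
by rewrite /inner => <-; ring.
Qed.

Lemma covdD V W X : derivable V u X -> derivable W u X ->
  covd G f (fun z => V z + W z) X u = covd G f V X u + covd G f W X u.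
Proof.
move=> dV dW; rewrite /covd GammaDr// addrACA; congr (_ + _).
exact: (deriveD dV dW).
Qed.

Lemma covdZ V X (k : R) : derivable V u X ->
  covd G f (fun z => k *: V z) X u = k *: covd G f V X u.
Proof.
move=> dV; rewrite /covd GammaZr// scalerDr; congr (_ + _).
exact: (deriveZ k dV).
Qed.

Variable J : 'rV[R]_m -> 'M[R]_m.
Hypotheses (dJ : differentiable J (f u))
  (parJ : forall v w : 'rV[R]_m, covd G idfun (fun z => w *m J z) v (f u) =
    covd G idfun (fun=> w) v (f u) *m J (f u)).

Lemma is_derive_mulJ V X : derivable V u X ->
  is_derive u X (fun z => V z *m J (f z))
   ('D_X V u *m J (f u) + V u *m 'd J (f u) ('d f u X)).
Proof.
move=> /derivableP dV; rewrite -deriveE//.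
exact: is_derive_mulmx dV (is_derive_comp X df dJ).
Qed.

(** By the product rule, the derivative of [J] enters only through the value [V u], so [parJ] for
    the constant field [V u] suffices. *)
Lemma covd_J V X : derivable V u X ->
  covd G f (fun z => V z *m J (f z)) X u = covd G f V X u *m J (f u).
Proof.
move=> dV; have [_ E] := is_derive_mulJ dV.
rewrite /covd E mulmxDl -addrA; congr (_ + _).
have := parJ ('d f u X) (V u); rewrite /covd.
rewrite (diff_val : 'd (@idfun 'rV[R]_m) (f u) = id :> (_ -> _)).
have [_ ->] := is_derive_mulmx (is_derive_cst (V u) (f u) ('d f u X))
  (derivableP (@diff_derivable _ _ _ J (f u) ('d f u X) dJ)).
by rewrite mul0mx add0r derive_cst add0r deriveE//.
Qed.

End along.

(** * The variation of the angle along a surface *)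

Section surface.
Context {R : realType} {m : nat}.
Variables (G J : 'rV[R]_m -> 'M[R]_m) (f : 'rV[R]_2 -> 'rV[R]_m) (u : 'rV[R]_2).
Let y := f u.
Let L := jacobian f u.
Hypotheses (sG : spd (G y)) (dG : differentiable G y)
  (Gs : \forall z \near y, (G z)^T = G z) (df : differentiable f u)
  (ddf : forall X Y, derivable (fun z => 'd f z Y) u X)
  (ddfC : forall X Y, 'D_X (fun z => 'd f z Y) u = 'D_Y (fun z => 'd f z X) u)
  (Lf : row_free L)
  (dJ : differentiable J y) (JJ : J y *m J y = - 1%:M)
  (JG : forall v w, inner (G y) (v *m J y) (w *m J y) = inner (G y) v w)
  (parJ : forall v w : 'rV[R]_m, covd G idfun (fun z => w *m J z) v y =
    covd G idfun (fun=> w) v y *m J y).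

Definition nproj (G : 'M[R]_m) (L : 'M[R]_(2, m)) (v : 'rV[R]_m) : 'rV[R]_m :=
  v - v *m tproj G L.

Definition sff (X Y : 'rV[R]_2) : 'rV[R]_m :=
  nproj (G y) L (covd G f (fun z => 'd f z Y) X u).

Definition normal_J (X : 'rV[R]_2) : 'rV[R]_m :=
  nproj (G y) L ('d f u X *m J y).

Lemma nprojD v w : nproj (G y) L (v + w) = nproj (G y) L v + nproj (G y) L w.
Proof. by rewrite /nproj mulmxDl opprD addrACA. Qed.

Lemma nprojZ (k : R) v : nproj (G y) L (k *: v) = k *: nproj (G y) L v.
Proof. by rewrite /nproj scalerBr scalemxAl. Qed.

Lemma normal_JD X Y : normal_J (X + Y) = normal_J X + normal_J Y.
Proof. by rewrite /normal_J linearD mulmxDl nprojD. Qed.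

Lemma normal_JZ (k : R) X : normal_J (k *: X) = k *: normal_J X.
Proof. by rewrite /normal_J linearZ -scalemxAl nprojZ. Qed.

(** Second derivatives of [f] commute and the connection is torsion-free. *)
Lemma sff_sym X Y : sff X Y = sff Y X.
Proof.
by rewrite /sff /covd ddfC (Gamma_sym sG dG Gs).
Qed.

Lemma sffDr X Y Z : sff X (Y + Z) = sff X Y + sff X Z.
Proof.
have E : (fun z => 'd f z (Y + Z)) = (fun z => 'd f z Y + 'd f z Z).
  by apply/funext => z; rewrite linearD.
by rewrite /sff E (covdD sG dG (@ddf X Y) (@ddf X Z)) nprojD.
Qed.

Lemma sffZr (k : R) X Y : sff X (k *: Y) = k *: sff X Y.
Proof.
have E : (fun z => 'd f z (k *: Y)) = (fun z => k *: 'd f z Y).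
  by apply/funext => z; rewrite linearZ.
by rewrite /sff E (covdZ sG dG k (@ddf X Y)) nprojZ.
Qed.

Lemma nproj_orth v (X : 'rV[R]_2) :
  inner (G y) (nproj (G y) L v) ('d f u X) = 0.
Proof. by rewrite -(tproj_orth sG Lf v X) /L mul_rV_lin1. Qed.

Lemma nproj_decomp v : exists a b,
  v = a *: 'd f u (delta_mx 0 0) + b *: 'd f u (delta_mx 0 1) + nproj (G y) L v.
Proof.
pose t := v *m (G y *m L^T *m invmx (L *m G y *m L^T)).
exists (t 0 0), (t 0 1).
rewrite -!linearZ -linearD -row2E -[X in X + _]mul_rV_lin1.
by rewrite /nproj /tproj /t !mulmxA addrC subrK.
Qed.

Lemma nproj_inner v w :
  inner (G y) (nproj (G y) L v) w =
  inner (G y) (nproj (G y) L v) (nproj (G y) L w).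
Proof.
have [a [b E]] := nproj_decomp w.
by rewrite {1}E !innerDr !innerZr !nproj_orth !mulr0 !add0r.
Qed.

Definition gram_det z := \det (jacobian f z *m G (f z) *m (jacobian f z)^T).

(** The pulled-back Kaehler form on the coordinate frame, the function w of the overview. *)
Definition kaehler_form z := inner (G (f z))
  ('d f z (delta_mx 0 0) *m J (f z)) ('d f z (delta_mx 0 1)).

(** The expression S(X) of the overview. *)
Definition defect X :=
  inner (G y) (sff X (delta_mx 0 1)) (normal_J (delta_mx 0 0)) -
  inner (G y) (sff X (delta_mx 0 0)) (normal_J (delta_mx 0 1)).

(* [t] is the trace of the tangential part of the derivative along [X] of the
   frame; it cancels in the quotient defining [wirtinger]. *)
Lemma is_derive_form_gram X : exists t,
  is_derive u X kaehler_form (t * kaehler_form u + defect X) /\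
  is_derive u X gram_det (2 * t * gram_det u).
Proof.
pose E i z := 'd f z (delta_mx 0 i : 'rV[R]_2).
have dE i : derivable (E i) u X by exact: ddf.
pose D i := covd G f (E i) X u.
pose q i j z : R := inner (G (f z)) (E i z) (E j z).
have qs i j : q i j u = q j i u by rewrite /q sG.1.
have [a0 [b0 D0]] := nproj_decomp (D 0).
have [a1 [b1 D1]] := nproj_decomp (D 1).
exists (a0 + b1); split.
  have /= [dEJ _] := is_derive_mulJ df dJ (dE 0).
  have cJ : covd G f (fun z => E 0 z *m J (f z)) X u = D 0 *m J y.
    exact: (covd_J df dJ parJ (dE 0)).
  apply: (is_derive_eq (is_derive_inner sG dG Gs df dEJ (dE 1))).
  rewrite cJ -/(D 1) (inner_J_skew JJ JG) /defect /sff /normal_J.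
  have wE : kaehler_form u = inner (G y) (E 0 u *m J y) (E 1 u) by [].
  have w1 : inner (G y) (E 0 u) (E 1 u *m J y) = - kaehler_form u.
    by rewrite wE (inner_J_skew JJ JG) opprK.
  have w0 : inner (G y) (E 1 u) (E 1 u *m J y) = 0.
    by rewrite sG.1 (inner_J_alt sG JJ JG).
  have w2 : inner (G y) (E 0 u *m J y) (E 0 u) = 0.
    by rewrite (inner_J_alt sG JJ JG).
  (* Against [E 1 u *m J y] the [E 1] component of [D 0] contributes nothing, [J] being skew; the
     coefficient [a0] and the normal part remain. The same happens with [b1] in [e1]. *)
  have e0 : inner (G y) (D 0) (E 1 u *m J y) = - a0 * kaehler_form u +
      inner (G y) (nproj (G y) L (D 0)) (nproj (G y) L (E 1 u *m J y)).
    rewrite -nproj_inner; move: (nproj _ _ _) D0 => n0 ->.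
    by rewrite !innerDl !innerZl w1 w0; ring.
  have e1 : inner (G y) (E 0 u *m J y) (D 1) = b1 * kaehler_form u +
      inner (G y) (nproj (G y) L (D 1)) (nproj (G y) L (E 0 u *m J y)).
    rewrite -nproj_inner; move: (nproj _ _ _) D1 => n1 ->.
    by rewrite !innerDr !innerZr w2 -wE (sG.1 n1); ring.
  rewrite e0 [X in _ + X]e1 /D /E; ring.
have dq i j : is_derive u X (q i j)
    (inner (G y) (D i) (E j u) + inner (G y) (E i u) (D j)).
  exact: (is_derive_inner sG dG Gs df (dE i) (dE j)).
have aE : gram_det = q 0 0 * q 1 1 - q 0 1 * q 1 0.
  apply/funext => z; rewrite /gram_det det2E.
  rewrite -!inner_delta -!inner_pullback !mul_rV_lin1. by [].
rewrite aE; apply: (is_derive_eq (is_deriveB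
  (is_deriveM (dq 0 0) (dq 1 1)) (is_deriveM (dq 0 1) (dq 1 0)))).
have i0 j : inner (G y) (D 0) (E j u) = a0 * q 0 j u + b0 * q 1 j u.
  move: D0 (nproj_orth (D 0) (delta_mx 0 j)); move: (nproj _ _ _) => n0 -> H.
  by rewrite !innerDl !innerZl H addr0.
have i1 j : inner (G y) (D 1) (E j u) = a1 * q 0 j u + b1 * q 1 j u.
  move: D1 (nproj_orth (D 1) (delta_mx 0 j)); move: (nproj _ _ _) => n0 -> H.
  by rewrite !innerDl !innerZl H addr0.
rewrite !(sG.1 (E _ _)) !i0 !i1 !(qs 1 0) /GRing.scale/=.
by rewrite -![(_ - _) u]/(_ - _) -![(_ * _) u]/(_ * _) (qs 1 0); ring.
Qed.

(* As [sff] is symmetric, both sides say that [<sff X Z, normal_J Y>] is totally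
   symmetric in [X], [Y], [Z]. *)
Lemma defect0P : (forall X, defect X = 0) <->
  forall X Y Z,
    inner (G y) (sff X Z) (normal_J Y) = inner (G y) (sff Y Z) (normal_J X).
Proof.
split=> [d0 X Y Z|H X]; last first.
  by rewrite /defect H sff_sym H subrr.
(* For fixed [X'] the expression is bilinear in [Y'] and [Z'], and the vanishing of [defect X'] is
   its symmetry on the basis. *)
have Yc X' Y' Z' :
    inner (G y) (sff X' Z') (normal_J Y') =
    inner (G y) (sff X' Y') (normal_J Z').
  apply: (@bilinear2_sym _ (fun Z Y => inner (G y) (sff X' Z) (normal_J Y))).
  - by move=> *; rewrite sffDr innerDl.
  - by move=> *; rewrite sffZr innerZl.
  - by move=> *; rewrite normal_JD innerDr.
  - by move=> *; rewrite normal_JZ innerZr.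
  - exact/esym/subr0_eq/d0.
by rewrite sff_sym Yc sff_sym.
Qed.

End surface.

(** * Immersed surfaces in charts *)

Lemma open_local_dom (R : realType) n m (N M : topologicalType) (f : N -> M)
    (c : chart R n N) (d : chart R m M) :
  continuous f -> open (local_dom f c d).
Proof.
move=> cf; rewrite openE => u [uc ud]; apply: filterI.
  by apply: open_nbhs_nbhs; split=> //; exact: chart_cod_open.
have cfi : {for u, continuous (f \o chart_inv c)}.
  by apply: continuous_comp; [exact: chart_inv_continuous|exact: cf].
by apply: cfi; apply: open_nbhs_nbhs; split=> //; exact: chart_dom_open.
Qed.

Definition chart_at (R : realType) (n : nat) (P : manifold R n) (p : P) :
  chart R n P :=
  sval (cid2 (atlas_cover p)).

Lemma atlas_chart_at (R : realType) n (P : manifold R n) (p : P) :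
  atlas (chart_at p).
Proof. exact: s2valP (cid2 (atlas_cover p)). Qed.

Lemma chart_at_dom (R : realType) n (P : manifold R n) (p : P) :
  chart_dom (chart_at p) p.
Proof. exact: s2valP' (cid2 (atlas_cover p)). Qed.

(** All preimages under [F] are open, so a level set is both open and closed. *)
Lemma locally_constant_cst (R : realType) n (P : manifold R n) (F : P -> R) :
  (forall p, \forall q \near p, F q = F p) -> forall p q, F p = F q.
Proof.
move=> Fc p q.
have oF (S : set R) : open (F @^-1` S).
  rewrite openE => x Sx; apply: filterS (Fc x) => z.
  by rewrite /preimage/= => ->.
suff : F @^-1` [set F q] = setT by move=> E; have : setT p by []; rewrite -E.
apply: (@manifold_connected R n P); first by exists q.
- by exists (F @^-1` [set F q]); rewrite ?setTI.
- exists (F @^-1` [set F q]); rewrite ?setTI// -openC.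
  exact: (oF (~` [set F q])).
Qed.

Section local.
Context {R : realType} {m : nat}.
Variables (M : manifold R m) (g : riemannian_metric M) (J : almost_complex M)
  (N : manifold R 2) (f : immersion N M) (kJ : kaehlerian g J).
Variables (c : chart R 2 N) (d : chart R m M) (ac : atlas c) (ad : atlas d).
Let phi := local_rep f c d.
Let U := local_dom f c d.

Lemma open_chart_dom : open U.
Proof. exact/open_local_dom/imm_continuous. Qed.

Lemma near_chart_dom u : U u -> \forall z \near u, U z.
Proof.
by move=> Uu; apply: open_nbhs_nbhs; split=> //; exact: open_chart_dom.
Qed.

Lemma phi_cod u : U u -> chart_cod d (phi u).
Proof. by move=> [_ ud]; exact: chart_mapP. Qed.

Lemma metric_spd y : chart_cod d y -> spd (g d y).
Proof.
by move=> yd; split=> [v w|v];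
  [exact: (Defs.metric_sym g ad yd)|exact: (Defs.metric_pos g ad yd)].
Qed.

Lemma metric_near_sym y : chart_cod d y -> \forall z \near y, (g d z)^T = g d z.
Proof.
move=> yd; have : nbhs y (chart_cod d).
  by apply: open_nbhs_nbhs; split=> //; exact: chart_cod_open.
by apply: filterS => z zd; exact/spd_sym/metric_spd.
Qed.

Lemma metric_diff y : chart_cod d y -> differentiable (g d) y.
Proof. by move=> yd; apply: (metric_smooth g ad 1).1. Qed.

Lemma acs_diff y : chart_cod d y -> differentiable (J d) y.
Proof. by move=> yd; apply: (acs_smooth J ad 1).1. Qed.

Lemma phi_Ck k : Ck k U phi.
Proof. exact: imm_smooth. Qed.

Lemma phi_diff u : U u -> differentiable phi u.
Proof. exact: (phi_Ck 1).1. Qed.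

Lemma phi_near_deriveE u Y : U u -> \forall z \near u, 'D_Y phi z = 'd phi z Y.
Proof.
move=> Uu; apply: filterS (near_chart_dom Uu) => z Uz.
by rewrite deriveE//; exact: phi_diff.
Qed.

Lemma phi_derivable_diff u X Y : U u -> derivable (fun z => 'd phi z Y) u X.
Proof.
move=> Uu; apply: near_eq_derivable (phi_near_deriveE Y Uu) _.
by apply: diff_derivable; apply: ((phi_Ck 2).2 Y).1.
Qed.

Lemma phi_diff_comm u X Y : U u ->
  'D_X (fun z => 'd phi z Y) u = 'D_Y (fun z => 'd phi z X) u.
Proof.
move=> Uu; rewrite -(near_eq_derive _ (phi_near_deriveE Y Uu)).
rewrite -(near_eq_derive _ (phi_near_deriveE X Uu)).
exact: Ck2_derive_comm open_chart_dom (phi_Ck 2) Uu.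
Qed.

Lemma phi_row_free u : U u -> row_free (jacobian phi u).
Proof.
move=> Uu; apply: inj_row_free => v; rewrite mul_rV_lin1 => v0.
by apply: (imm_injective ac ad Uu); rewrite v0 linear0.
Qed.

Lemma tangent_spaceE u :
  tangent_space f c d u = range (fun X : 'rV[R]_2 => X *m jacobian phi u).
Proof.
have -> : (fun X : 'rV[R]_2 => X *m jacobian phi u) = tangent_map f c d u.
  by apply/funext => X; rewrite mul_rV_lin1.
by [].
Qed.

Definition wirtinger_chart u :=
  wirtinger (g d (phi u)) (J d (phi u)) (jacobian phi u).

(** The right side is free of [X]: on a surface the angle depends on the point only, and slantness
    becomes constancy of [wirtinger_chart]. *)
Lemma angle_to_wirtinger_chart u X : U u -> X != 0 ->
  angle_to (ambient_metric g f c d u) (J_tangent J f c d u X)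
      (tangent_space f c d u) = acos (Num.sqrt (wirtinger_chart u)).
Proof.
move=> Uu X0; have yd := phi_cod Uu.
rewrite tangent_spaceE /J_tangent /tangent_map -/phi -mul_rV_lin1.
apply: angle_toE => //.
- exact: metric_spd.
- exact: (acs_square J ad yd).
- exact: (kJ ad yd).1.
- exact: phi_row_free.
Qed.

Lemma F_normalE u X : U u ->
  F_normal g J f c d u X = normal_J (g d) (J d) phi u X.
Proof.
move=> Uu; rewrite /F_normal tangent_spaceE.
rewrite (normal_tproj (metric_spd (phi_cod Uu)))//.
exact: phi_row_free.
Qed.

Lemma second_fundamental_formE u X Y : U u ->
  second_fundamental_form g f c d u X Y = sff (g d) phi u X Y.
Proof.
move=> Uu; rewrite /second_fundamental_form tangent_spaceE.
rewrite (normal_tproj (metric_spd (phi_cod Uu)))//; exact: phi_row_free.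
Qed.

(** The right side is linear in [Y], so [riesz2] for the pulled-back metric provides a vector and
    [xget] does not fall back on its default. *)
Lemma weingartenP u xi X : U u -> forall Y,
  inner (g d (phi u)) ('d phi u (weingarten g f c d u xi X)) ('d phi u Y) =
  inner (g d (phi u)) (sff (g d) phi u X Y) xi.
Proof.
move=> Uu; have sG := metric_spd (phi_cod Uu).
have sA := spd_pullback (phi_row_free Uu) sG.
have [||w wP] := @riesz2 _ _
  (fun Y => inner (g d (phi u)) (sff (g d) phi u X Y) xi) sA.
- move=> Y Y'; rewrite -innerDl sffDr//.
  + exact/metric_diff/phi_cod.
  + by move=> *; exact: phi_derivable_diff.
- move=> k Y; rewrite -innerZl sffZr//.
  + exact/metric_diff/phi_cod.
  + by move=> *; exact: phi_derivable_diff.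
have : exists W, forall Y,
    inner (ambient_metric g f c d u)
      (tangent_map f c d u W) (tangent_map f c d u Y) =
    inner (ambient_metric g f c d u)
      (second_fundamental_form g f c d u X Y) xi.
  exists w => Y; rewrite second_fundamental_formE// -wP -inner_pullback.
  by rewrite !mul_rV_lin1.
move=> /(xgetPex 0) H Y; rewrite -second_fundamental_formE//; exact: H.
Qed.

Lemma weingarten_symP u : U u ->
  (forall X Y, weingarten g f c d u (F_normal g J f c d u Y) X =
     weingarten g f c d u (F_normal g J f c d u X) Y) <->
  forall X, defect (g d) (J d) phi u X = 0.
Proof.
move=> Uu; have yd := phi_cod Uu.
have dP := defect0P (J d) (metric_spd yd) (metric_diff yd) (metric_near_sym yd)
  (fun X Y => @phi_derivable_diff u X Y Uu) (fun X Y => phi_diff_comm X Y Uu).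
apply: iff_trans (iff_sym dP).
split=> [H X Y Z|H X Y].
  have EX := weingartenP (F_normal g J f c d u X) Y Uu Z.
  have EY := weingartenP (F_normal g J f c d u Y) X Uu Z.
  rewrite H EX in EY; apply: etrans (etrans (esym EY) _).
    by rewrite (F_normalE _ Uu).
  by rewrite (F_normalE _ Uu).
(* Both sides are choices from sets, and [H] shows that the two sets are equal. *)
apply: (congr1 (xget 0)); apply/seteqP.
by split=> W WP Z; apply: etrans (WP Z) _;
  rewrite !(second_fundamental_formE _ _ Uu) !(F_normalE _ Uu); exact: H.
Qed.

Lemma gram_det_gt0 u : U u -> 0 < gram_det (g d) phi u.
Proof.
move=> Uu; apply/spd_det2_gt0/spd_pullback; first exact: phi_row_free.
exact/metric_spd/phi_cod.
Qed.

Lemma wirtinger_chartE u : U u ->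
  wirtinger_chart u =
  kaehler_form (g d) (J d) phi u ^+ 2 / gram_det (g d) phi u.
Proof.
move=> Uu; have yd := phi_cod Uu; rewrite /wirtinger_chart wirtingerE.
- rewrite -inner_delta -inner_pullback inner_mulJ !mul_rV_lin1. by [].
- exact: metric_spd.
- exact: (acs_square J ad yd).
- exact: (kJ ad yd).1.
Qed.

Lemma is_derive_chart_parts u X : U u -> exists t,
  is_derive u X (kaehler_form (g d) (J d) phi)
    (t * kaehler_form (g d) (J d) phi u + defect (g d) (J d) phi u X) /\
  is_derive u X (gram_det (g d) phi) (2 * t * gram_det (g d) phi u).
Proof.
move=> Uu; have yd := phi_cod Uu; apply: is_derive_form_gram.
- exact: metric_spd.
- exact: metric_diff.
- exact: metric_near_sym.
- exact: phi_diff.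
- by move=> *; exact: phi_derivable_diff.
- exact: phi_row_free.
- exact: acs_diff.
- exact: (acs_square J ad yd).
- exact: (kJ ad yd).1.
- exact: (kJ ad yd).2.
Qed.

(** The trace [t] cancels in the quotient rule, since the square of the Kaehler form and the Gram
    determinant both grow at the rate [2 * t]. *)
Lemma is_derive_wirtinger_chart u X : U u -> is_derive u X wirtinger_chart
  (2 * kaehler_form (g d) (J d) phi u * defect (g d) (J d) phi u X /
   gram_det (g d) phi u).
Proof.
move=> Uu; have [t []] := is_derive_chart_parts X Uu.
have : gram_det (g d) phi u != 0 by rewrite gt_eqF// gram_det_gt0.
have : \forall z \near u, wirtinger_chart z =
    kaehler_form (g d) (J d) phi z ^+ 2 / gram_det (g d) phi z.
  by apply: filterS (near_chart_dom Uu) => z; exact: wirtinger_chartE.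
move: (defect _ _ _ _ _) (kaehler_form _ _ _) (gram_det _ _) => s w a.
move=> E a0 dw [da aE].
have dV : is_derive u X (fun z => (a z)^-1 : R) (- a u ^- 2 *: (2 * t * a u)).
  by split; [exact: derivableV|rewrite deriveV// aE].
have H : is_derive u X (fun z => w z ^+ 2 / a z : R) (2 * w u * s / a u).
  apply: (is_derive_eq (is_deriveM (is_deriveM dw dw) dV)).
  rewrite -[(w * w) u]/(w u * w u) /GRing.scale/=.
  by field.
by apply: near_eq_is_derive H; apply: filterS E => z ->.
Qed.

Lemma wirtinger_chart_cst_defect0 k :
  (forall z, U z -> wirtinger_chart z = k) ->
  forall u X, U u -> defect (g d) (J d) phi u X = 0.
Proof.
move=> Wk u X Uu; have a0 := gram_det_gt0 Uu.
(* If the Kaehler form vanishes at [u], then [k = 0] and it vanishes on the whole chart; its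
   derivative at [u], which is then the defect, is zero. Otherwise the derivative of
   [wirtinger_chart] is divided by the nonzero factor. *)
have [w0|w0] := eqVneq (kaehler_form (g d) (J d) phi u) 0.
  have k0 : k = 0 by rewrite -(Wk _ Uu) (wirtinger_chartE Uu) w0 expr0n mul0r.
  have wz z : U z -> kaehler_form (g d) (J d) phi z = 0.
    move=> Uz; have := wirtinger_chartE Uz; rewrite (Wk _ Uz) k0 => /esym/eqP.
    rewrite mulf_eq0 invr_eq0 (gt_eqF (gram_det_gt0 Uz)) orbF expf_eq0/=.
    exact: eqP.
  have [t [[_ +] _]] := is_derive_chart_parts X Uu.
  rewrite w0 mulr0 add0r => <-.
  apply: etrans (derive_cst 0 u X); apply: near_eq_derive.
  by apply: filterS (near_chart_dom Uu) => z /wz.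
have [_ E] := is_derive_wirtinger_chart X Uu.
have D0 : 'D_X wirtinger_chart u = 0.
  apply: etrans (derive_cst k u X).
  apply: near_eq_derive.
  by apply: filterS (near_chart_dom Uu) => z /Wk.
move: E; rewrite D0 => /esym/eqP.
by rewrite !mulf_eq0 invr_eq0 (gt_eqF a0) pnatr_eq0 (negbTE w0) orbF => /eqP.
Qed.

Lemma defect0_wirtinger_chart_near_cst u :
  (forall z X, U z -> defect (g d) (J d) phi z X = 0) -> U u ->
  \forall z \near u, wirtinger_chart z = wirtinger_chart u.
Proof.
move=> d0 Uu; have /nbhs_ballP[r /= r0 rU] := near_chart_dom Uu.
have C z : ball u r z -> wirtinger_chart z = wirtinger_chart u.
  apply: derive0_ball_cst => z' v /rU Uz'.
  apply: (is_derive_eq (is_derive_wirtinger_chart v Uz')).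
  by rewrite (d0 _ _ Uz') mulr0 mul0r.
by apply: filterS C _; exact: nbhsx_ballx.
Qed.

End local.

(** * Independence of the charts and constancy on the surface *)

Section global.
Context {R : realType} {m : nat}.
Variables (M : manifold R m) (g : riemannian_metric M) (J : almost_complex M)
  (N : manifold R 2) (f : immersion N M) (kJ : kaehlerian g J).

(** The transition maps and the two local expressions of [f] form a square commuting near [u]; its
    Jacobians, with the transformation laws of [g] and [J], fit [wirtinger_pullback]. *)
Lemma wirtinger_chart_change (p : N) c c' d d' :
  atlas c -> atlas c' -> atlas d -> atlas d' ->
  chart_dom c p -> chart_dom c' p -> chart_dom d (f p) -> chart_dom d' (f p) ->
  wirtinger_chart g J f c d (chart_map c p) =
  wirtinger_chart g J f c' d' (chart_map c' p).
Proof.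
move=> ac ac' ad ad' pc pc' pd pd'.
pose u := chart_map c p; pose tau := local_rep idfun c c'.
pose sig := local_rep idfun d d'; pose phi := local_rep f c d.
have Uu : local_dom f c d u.
  by split; [exact: chart_mapP|rewrite chart_mapK].
have tu : tau u = chart_map c' p by rewrite /tau /local_rep chart_mapK.
have Uu' : local_dom f c' d' (tau u).
  by rewrite tu; split; [exact: chart_mapP|rewrite chart_mapK].
have phiu : phi u = chart_map d (f p) by rewrite /phi /local_rep chart_mapK.
have Tu : local_dom idfun c c' u.
  by split; [exact: chart_mapP|rewrite chart_mapK].
have Su : local_dom idfun d d' (phi u).
  by rewrite phiu; split; [exact: chart_mapP|rewrite chart_mapK].
have sphi : sig (phi u) = local_rep f c' d' (tau u).
  by rewrite /sig phiu tu /local_rep !chart_mapK.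
have yd : chart_cod d (phi u) by case: Su.
rewrite -tu /wirtinger_chart -/phi -/u.
apply: (@wirtinger_pullback _ _ _ _ _ _ _ _ _
  (jacobian tau u) (jacobian sig (phi u))).
- exact: (metric_spd g ad yd).
- exact: (phi_row_free ac ad Uu).
- apply: jacobian_square.
  + exact: (phi_diff ac ad Uu).
  + exact: ((atlas_smooth ad ad' 1).1 _ Su).
  + exact: ((atlas_smooth ac ac' 1).1 _ Tu).
  + exact: (phi_diff ac' ad' Uu').
  + have oT : nbhs u (local_dom idfun c c').
      apply: open_nbhs_nbhs; split=> //.
      by apply: open_local_dom => x; exact: cvg_id.
    have oU : nbhs u (local_dom f c d) by exact: near_chart_dom.
    apply: filterS2 oT oU => z [zc zc'] [_ zd].
    by rewrite /sig /phi /tau /local_rep /= chart_mapK// chart_mapK.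
- by rewrite -sphi; exact: (metric_transform g ad ad' Su).
- by rewrite -sphi; exact: (acs_transform J ad ad' Su).
Qed.

(** A function on [N] itself, to which connectedness can be applied; by [wirtinger_atE] the chosen
    charts are immaterial. *)
Definition wirtinger_at (p : N) : R :=
  wirtinger_chart g J f (chart_at p) (chart_at (f p))
    (chart_map (chart_at p) p).

Lemma wirtinger_atE (p : N) c d : atlas c -> atlas d ->
  chart_dom c p -> chart_dom d (f p) ->
  wirtinger_at p = wirtinger_chart g J f c d (chart_map c p).
Proof.
by move=> ac ad pc pd; apply: wirtinger_chart_change => //;
  (exact: atlas_chart_at || exact: chart_at_dom).
Qed.

Lemma wirtinger_at_near_cst :
  (forall c d, atlas c -> atlas d -> forall u, local_dom f c d u ->
    forall X, defect (g d) (J d) (local_rep f c d) u X = 0) ->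
  forall p, \forall q \near p, wirtinger_at q = wirtinger_at p.
Proof.
move=> d0 p; pose c := chart_at p; pose d := chart_at (f p).
have ac : atlas c by exact: atlas_chart_at.
have ad : atlas d by exact: atlas_chart_at.
have pc : chart_dom c p by exact: chart_at_dom.
have pd : chart_dom d (f p) by exact: chart_at_dom.
have Uu : local_dom f c d (chart_map c p).
  by split; [exact: chart_mapP|rewrite chart_mapK].
have W := defect0_wirtinger_chart_near_cst kJ ac ad
  (fun z X Uz => d0 c d ac ad z Uz X) Uu.
have nW : \forall q \near p,
    wirtinger_chart g J f c d (chart_map c q) =
    wirtinger_chart g J f c d (chart_map c p).
  exact: (chart_map_continuous pc W).
have nc : nbhs p (chart_dom c).
  by apply: open_nbhs_nbhs; split=> //; exact: chart_dom_open.
have nd : nbhs p (f @^-1` chart_dom d).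
  apply: (@imm_continuous _ _ _ _ _ f p).
  by apply: open_nbhs_nbhs; split=> //; exact: chart_dom_open.
apply: filterS3 nW nc nd => q Wq qc qd.
by rewrite (wirtinger_atE ac ad qc qd) (wirtinger_atE ac ad pc pd).
Qed.

End global.

Theorem corollary3p6 (R : realType) (m : nat) (M : manifold R m)
    (g : riemannian_metric M) (J : almost_complex M)
    (N : manifold R 2) (f : immersion N M) :
  kaehlerian g J ->
  (slant g J f <->
   forall (c : chart R 2 N) (d : chart R m M), atlas c -> atlas d ->
   forall u : 'rV[R]_2, local_dom f c d u ->
   forall X Y : 'rV[R]_2,
     weingarten g f c d u (F_normal g J f c d u Y) X =
     weingarten g f c d u (F_normal g J f c d u X) Y).
Proof.
move=> kJ; split=> [[theta slantf] c d ac ad|H].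
  (* Slantness says that [acos] of the square root is [theta]; since the value lies in [0, 1],
     taking cosines and squaring recovers it. *)
  have Wk z : local_dom f c d z -> wirtinger_chart g J f c d z = cos theta ^+ 2.
    move=> Uz; have zd := phi_cod Uz.
    have e0 : (delta_mx 0 0 : 'rV[R]_2) != 0.
      by apply/eqP => /matrixP/(_ 0 0)/eqP; rewrite delta2 mxE oner_eq0.
    have /andP[W0 W1] : 0 <= wirtinger_chart g J f c d z <= 1.
      apply: wirtinger_itv (metric_spd g ad zd) (acs_square J ad zd) _ _.
        exact: (kJ d ad _ zd).1.
      exact: (phi_row_free ac ad Uz).
    have := slantf c d ac ad z Uz _ e0.
    rewrite (angle_to_wirtinger_chart kJ ac ad Uz e0) => <-.
    rewrite acosK ?sqr_sqrtr// in_itv/= (le_trans _ (sqrtr_ge0 _)) ?lerN10//=.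
    by rewrite -[leRHS]sqrtr1 ler_wsqrtr.
  move=> u Uu; apply: (weingarten_symP g J ac ad Uu).2 => X.
  exact: (wirtinger_chart_cst_defect0 kJ ac ad Wk).
have d0 c d : atlas c -> atlas d -> forall u, local_dom f c d u ->
    forall X, defect (g d) (J d) (local_rep f c d) u X = 0.
  by move=> ac ad u Uu; apply: (weingarten_symP g J ac ad Uu).1; exact: H.
have C := locally_constant_cst (wirtinger_at_near_cst kJ d0).
(* Connectedness does not exclude the empty surface, which has no base point and for which any angle
   serves. *)
have [[p0 _]|N0] := pselect (exists p : N, True); last first.
  by exists 0 => c d ac ad u Uu; case: N0; exists (chart_inv c u).
exists (acos (Num.sqrt (wirtinger_at g J f p0))) => c d ac ad u Uu X X0.
rewrite (angle_to_wirtinger_chart kJ ac ad Uu X0) (C p0 (chart_inv c u)).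
have [uc ud] := Uu.
by rewrite (wirtinger_atE g J ac ad (chart_invP uc) ud) chart_invK.
Qed.
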